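(* Let $G$ be a graph and let $\ell\ge 1$ be an integer. If $\mathrm{gir}(G)\ge 5$, then $$\mathrm{MH}_{\ell,\ell}(G)\cong \mathbb{Z}^{2\,\#E(G)},$$ where $\#E(G)$ denotes the number of edges of $G$.
   Context: A graph means a finite simple undirected graph without loops, with nonempty vertex set $V(G)$ and edge set $E(G)$ (not necessarily connected). An $i$-cycle ($i\ge 3$) in $G$ is a tuple $(x_0,\dots,x_i)$ of vertices with $\{x_k,x_{k+1}\}\in E(G)$ for $0\le k\le i-1$, $x_0=x_i$, and $x_0,\dots,x_{i-1}$ all distinct. The local girth at a vertex $x$ is $\mathrm{gir}_x(G)=\inf\{i\ge3 \mid \text{there is an } i\text{-cycle in } G \text{ containing } x\}$, with $\inf\emptyset=\infty$, and the girth is $\mathrm{gir}(G)=\min_{x\in V(G)}\mathrm{gir}_x(G)$. Let $d(x,y)$ be the length of a shortest path between $x$ and $y$ ($\infty$ if there is none), and $L(x_0,\dots,x_k)=\sum_{i=1}^k d(x_{i-1},x_i)$. For integers $k,\ell\ge 0$, $\mathrm{MC}_{k,\ell}(G)$ is the free $\mathbb{Z}$-module generated by the tuples $(x_0,\dots,x_k)\in V(G)^{k+1}$ with $x_{i-1}\ne x_i$ for all $1\le i\le k$ and $L(x_0,\dots,x_k)=\ell$; $\mathrm{MC}_{-1,\ell}(G)=0$. The boundary map $\partial_{k,\ell}:\mathrm{MC}_{k,\ell}(G)\to\mathrm{MC}_{k-1,\ell}(G)$ is given for $k\ge1$ by $\partial_{k,\ell}(x_0,\dots,x_k)=\sum_{i}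 (-1)^i (x_0,\dots,\hat{x}_i,\dots,x_k)$, the sum over those $1\le i\le k-1$ with $d(x_{i-1},x_{i+1})=d(x_{i-1},x_i)+d(x_i,x_{i+1})$ (the hat means deletion), and $\partial_{0,\ell}=0$. The magnitude homology is $\mathrm{MH}_{k,\ell}(G)=\ker\partial_{k,\ell}/\mathrm{Im}\,\partial_{k+1,\ell}$. *)

(* Defs.v *)
From HB Require Import structures.
From mathcomp Require Import all_boot all_order all_algebra.
From mathcomp Require Import ring_quotient boolp constructive_ereal.

Set Implicit Arguments.
Unset Strict Implicit.
Unset Printing Implicit Defensive.

Import Order.TTheory GRing.Theory Num.Theory.
Local Open Scope ring_scope.

(* Distances and girths take values in [\bar int]; -oo never occurs. *)
Definition inf_nat (P : pred nat) : \bar int :=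
  if pselect (exists n, P n) is left exP then ((ex_minn exP)%:Z)%:E else +oo%E.

Section Graph.
Variables (T : finType) (e : rel T).

Definition edges : {set {set T}} := [set [set x; y] | x in T, y in T & e x y].

(* In an (i+1)-tuple (x_0, ..., x_i), [take i] drops the repeated endpoint. *)
Definition icycle (i : nat) (c : i.+1.-tuple T) : bool :=
  [&& sorted e c, thead c == last (thead c) c & uniq (take i c)].

Definition local_girth (x : T) : \bar int :=
  inf_nat (fun i => (3 <= i)%N
    && [exists c : i.+1.-tuple T, icycle c && (x \in (c : seq T))]).

Definition girth : \bar int := \big[Order.min/+oo%E]_(x : T) local_girth x.

Definition dist (x y : T) : \bar int :=
  inf_nat (fun n => [exists p : n.-tuple T, path e x p && (last x p == y)]).

Definition vtx k (s : k.+1.-tuple T) (i : nat) : T := nth (thead s) s i.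

Definition len k (s : k.+1.-tuple T) : \bar int :=
  (\sum_(1 <= i < k.+1) dist (vtx s i.-1) (vtx s i))%E.

Definition is_gen k (l : nat) (s : k.+1.-tuple T) : bool :=
  [forall i : 'I_k, vtx s i != vtx s i.+1] && (len s == (l%:Z)%:E).

Definition gen k l := {s : k.+1.-tuple T | is_gen l s}.

Definition MC k l := {ffun gen k l -> int}.

Definition smooth k (s : k.+1.-tuple T) (i : nat) : bool :=
  (dist (vtx s i.-1) (vtx s i.+1)
   == dist (vtx s i.-1) (vtx s i) + dist (vtx s i) (vtx s i.+1))%E.

Definition del (i : nat) (s : seq T) : seq T := take i s ++ drop i.+1 s.

(* Value of the boundary on a generator; t ranges over the generators in degree
   k.  When i is smooth, [del i s] is again such a generator: it has the same
   length, and x_{i-1} != x_{i+1} because their distance is positive. *)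
Definition bd_gen k l (s : gen k.+1 l) : MC k l :=
  [ffun t : gen k l => \sum_(1 <= i < k.+1 | smooth (val s) i)
     ((-1) ^+ i * (tval (val t) == del i (val s))%:R : int)].

Definition bdS k l (c : MC k.+1 l) : MC k l :=
  [ffun t : gen k l => \sum_(s : gen k.+1 l) (c s * bd_gen s t : int)].

Lemma bdS_is_zmod_morphism k l : zmod_morphism (@bdS k l).
Proof.
move=> c d; apply/ffunP=> t; rewrite !ffunE -sumrB.
by apply: eq_bigr => s _; rewrite !ffunE mulrBl.
Qed.
HB.instance Definition _ k l :=
  GRing.isZmodMorphism.Build (MC k.+1 l) (MC k l) (@bdS k l)
    (@bdS_is_zmod_morphism k l).

(* MC_{k-1,l}, with MC_{-1,l} = 0 *)
Definition MCpred k l : zmodType :=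
  if k is k'.+1 then MC k' l else 'rV[int]_0.

Definition bd k l : {additive MC k l -> MCpred k l} :=
  match k return {additive MC k l -> MCpred k l} with
  | 0 => \0
  | k'.+1 => @bdS k' l
  end.

End Graph.

Section Homology.
Variables (A B C : zmodType) (f : {additive A -> B}) (g : {additive B -> C}).

Definition kerg : pred B := fun b => g b == 0.

Lemma kerg_closed : zmod_closed kerg.
Proof.
split=> [|x y]; rewrite !unfold_in /kerg ?raddf0 // => /eqP gx /eqP gy.
by rewrite raddfB gx gy subrr.
Qed.
HB.instance Definition _ := GRing.isZmodClosed.Build B kerg kerg_closed.

Record cycles := Cycle { cycle_val : B; _ : cycle_val \in kerg }.
HB.instance Definition _ := [isSub for cycle_val].
HB.instance Definition _ := [Choice of cycles by <:].
HB.instance Definition _ := [SubChoice_isSubZmodule of cycles by <:].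

Definition imf : pred cycles := fun z => `[< exists a, f a = val z >].

Lemma imf_closed : zmod_closed imf.
Proof.
split=> [|x y]; first by apply/asboolP; exists 0; rewrite !raddf0.
move=> /asboolP[a fa] /asboolP[b fb]; apply/asboolP; exists (a - b).
by rewrite !raddfB fa fb.
Qed.
HB.instance Definition _ := GRing.isZmodClosed.Build cycles imf imf_closed.

(* Image elements are taken inside [cycles]; for consecutive boundary maps
   g \o f = 0, so [imf] is the whole image of f. *)
Definition homology : zmodType := Quotient.quot (GRing.ZmodClosed.clone _ imf _).

End Homology.

Definition MH (T : finType) (e : rel T) (k l : nat) : zmodType :=
  homology (bd e k.+1 l) (bd e k l).

(* Main.v *)
(* Every step of a generator has length at least 1, so MC_{l+1,l} = 0, MC_{l,l}
   is free on the walks of length l, and MH_{l,l} is the kernel of the boundary.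
   Without 3- and 4-cycles, x_i is smooth in a walk iff x_{i-1} <> x_{i+1}, and
   a walk is determined by any of its smooth faces: the face has a single step
   of length 2, whose endpoints have a unique common neighbor.  So no
   cancellation occurs in the boundary, and the kernel is free on the walks
   without smooth vertex, i.e. (x, y, x, y, ...), one for each oriented edge. *)
Require Import Defs.
From mathcomp Require Import all_boot all_order all_algebra.
From mathcomp Require Import ring_quotient boolp constructive_ereal zify.
From HB Require Import structures.

Set Implicit Arguments.
Unset Strict Implicit.

(** * Homology when the incoming boundary vanishes *)

Section HomologyOfTrivialBoundaries.
Import GRing.Theory.
Local Open Scope ring_scope.
Local Open Scope quotient_scope.

(** Since [f] vanishes, the quotient identifies nothing and the homology is the kernel of [g]. On
    that kernel [F] is inverted by [G], which need not be known to be additive. *)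
Lemma homology_iso_kernel (A B C R : zmodType)
    (f : {additive A -> B}) (g : {additive B -> C})
    (F : {additive B -> R}) (G : R -> B) :
  (forall a, f a = 0) -> (forall v, g (G v) = 0) -> cancel G F ->
  (forall c, g c = 0 -> G (F c) = c) ->
  exists h : {additive homology f g -> R}, bijective h.
Proof.
move=> f0 gG GK FK.
(* Cycles with the same class differ by some [f a], which is 0. *)
have pi_inj (u v : cycles g) : \pi_(homology f g) u = \pi v -> u = v.
  move=> /eqP; rewrite -Quotient.idealrBE => /asboolP[a].
  rewrite f0 raddfB => /esym/eqP; rewrite subr_eq0 => /eqP.
  exact: val_inj.
(* By [pi_inj] a class has a single representative, so the choice made by [repr] is compatible with
   subtraction. *)
pose h (q : homology f g) : R := F (val (repr q)).
have h_morph : zmod_morphism h.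
  move=> x y; rewrite /h -raddfB; congr (F _).
  rewrite -(raddfB (\val : cycles g -> B)); congr val; apply: pi_inj.
  by rewrite raddfB /= !reprK.
pose hM := GRing.isZmodMorphism.Build _ _ h h_morph.
exists (HB.pack h hM : {additive homology f g -> R}).
have GvP v : G v \in kerg g by apply/eqP.
exists (fun v => \pi_(homology f g) (Cycle (GvP v))) => [q|v] /=.
  rewrite -[RHS]reprK; congr \pi; apply: val_inj => /=.
  by apply: FK; apply/eqP; exact: (valP (repr q)).
by rewrite /h (pi_inj _ _ (reprK _)) GK.
Qed.

End HomologyOfTrivialBoundaries.

(** * Extended distances: sums of terms at least 1, and the values 0, 1 and 2 *)

Section Distances.
Import Order.TTheory GRing.Theory Num.Theory.
Local Open Scope ring_scope.

Lemma inf_nat_geP (P : pred nat) n :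
  (n%:Z%:E <= inf_nat P)%E <-> forall m, P m -> (n <= m)%N.
Proof.
rewrite /inf_nat; case: pselect => [exP|nP]; last first.
  by rewrite leey; split=> // _ m Pm; case: nP; exists m.
case: ex_minnP => k Pk min_k; rewrite lee_fin lez_nat.
by split=> [nk m /min_k|]; [exact: leq_trans | apply].
Qed.

Lemma inf_nat_eqP (P : pred nat) n :
  inf_nat P = (n%:Z)%:E <-> P n /\ forall m, P m -> (n <= m)%N.
Proof.
rewrite /inf_nat; case: pselect => [exP|nP]; last first.
  by split=> // -[Pn _]; case: nP; exists n.
case: ex_minnP => k Pk min_k; split=> [[<-] //|[Pn min_n]].
by congr ((_ : nat)%:Z)%:E; apply/eqP; rewrite eqn_leq min_k ?min_n.
Qed.

Lemma adde_ge_succ (x y : \bar int) n :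
  (n%:Z%:E <= x)%E -> (1%:E <= y)%E ->
  (n.+1%:Z%:E <= x + y)%E
  /\ ((x + y)%E = n.+1%:Z%:E -> x = n%:Z%:E /\ y = 1%:E).
Proof.
case: x y => [x| |] [y| |] //; rewrite ?lee_fin => nx y1; try by split; rewrite ?leey.
split=> [|[xy]]; first lia.
by split; congr EFin; lia.
Qed.

(** Meant for the step lengths of a generator: the bound gives k <= l, and the equality case forces
    every step to be an edge when k = l. *)
Lemma esum_ge1_eq n (F : nat -> \bar int) :
  (forall i, (i < n)%N -> (1%:E <= F i)%E) ->
  (n%:Z%:E <= \sum_(0 <= i < n) F i)%E
  /\ ((\sum_(0 <= i < n) F i)%E = n%:Z%:E ->
      forall i, (i < n)%N -> F i = 1%:E).
Proof.
elim: n => [|n IHn] F1; first by rewrite big_nil.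
have [|leS eqS] := IHn; first by move=> i /leqW; exact: F1.
rewrite big_nat_recr //=.
have [le_S eq_S] := adde_ge_succ leS (F1 n (leqnn _)).
split=> // /eq_S[/eqS F1n Fn] i.
by rewrite ltnS leq_eqVlt => /predU1P[->|/F1n].
Qed.

Variables (T : finType) (e : rel T).

Lemma exists_pathP x y n :
  reflect (exists p, [/\ size p = n, path e x p & last x p = y])
          [exists p : n.-tuple T, path e x p && (last x p == y)].
Proof.
apply: (iffP existsP) => [[p /andP[px /eqP py]]|[p [<- px py]]].
  by exists p; rewrite size_tuple.
by exists (in_tuple p); rewrite px py eqxx.
Qed.

Lemma dist_eqP x y n :
  dist e x y = (n%:Z)%:E <->
  (exists p, [/\ size p = n, path e x p & last x p = y])
  /\ forall p, path e x p -> last x p = y -> (n <= size p)%N.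
Proof.
rewrite inf_nat_eqP; split=> [[/exists_pathP pP min_n]|[pP min_n]].
  by split=> // p px py; apply: min_n; apply/exists_pathP; exists p.
by split=> [|_ /exists_pathP[p [<- px py]]]; [exact/exists_pathP | exact: min_n].
Qed.

Lemma dist_ge1 x y : x != y -> (1%:E <= dist e x y)%E.
Proof.
move=> xy; apply/inf_nat_geP => m /exists_pathP[[|z p] [<- //= _ yx]].
by rewrite yx eqxx in xy.
Qed.

Lemma dist_refl x : dist e x x = 0%:E.
Proof. by apply/(dist_eqP x x 0); split=> //; exists [::]. Qed.

Lemma dist_eq1 x y : dist e x y = 1%:E -> e x y.
Proof.
by case/(dist_eqP x y 1) => -[[|z [|? ?]] [//= _ + <-]]; rewrite andbT.
Qed.

Hypothesis e_irr : irreflexive e.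

Lemma adj_neq x y : e x y -> x != y.
Proof. by apply: contraTneq => ->; rewrite e_irr. Qed.

Lemma dist_adj x y : e x y -> dist e x y = 1%:E.
Proof.
move=> exy; apply/(dist_eqP x y 1); split.
  by exists [:: y]; rewrite /= exy.
by case=> //= _ xy; rewrite xy e_irr in exy.
Qed.

Lemma dist_eq2 x z y :
  e x z -> e z y -> ~~ e x y -> x != y -> dist e x y = 2%:E.
Proof.
move=> exz ezy nexy xy; apply/(dist_eqP x y 2); split.
  by exists [:: z; y]; rewrite /= exz ezy.
case=> [_ /= /eqP|a [|b p] //=]; first by rewrite (negPf xy).
by rewrite andbT => exa ay; rewrite -ay exa in nexy.
Qed.

End Distances.

(** * Consequences of girth at least 5 *)

Section ShortCycles.
Import Order.TTheory.
Variables (T : finType) (e : rel T).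
Hypotheses (e_sym : symmetric e) (e_irr : irreflexive e).
Hypothesis girth_ge5 : (5%:E <= girth e)%E.

(** A cycle passes through its own first vertex, so its length bounds the local girth there, hence
    the girth. *)
Lemma girth_icycle i (c : i.+1.-tuple T) : 3 <= i -> icycle e c -> 5 <= i.
Proof.
move=> i3 ec; have le5 : (5%:E <= local_girth e (thead c))%E.
  by apply: le_trans girth_ge5 _; exact: bigmin_le.
apply: ((inf_nat_geP _ 5).1 le5); rewrite i3 /=.
by apply/existsP; exists c; rewrite ec mem_tnth.
Qed.

Lemma no_triangle x y z : e x y -> e y z -> ~~ e x z.
Proof.
move=> exy eyz; apply/negP => exz.
suff /girth_icycle : icycle e [tuple x; y; z; x] by move/(_ isT).
apply/and3P; split=> //; first by rewrite /= exy eyz e_sym exz.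
by rewrite /= !inE negb_or !(adj_neq e_irr).
Qed.

(** Two distinct common neighbors would close the 4-cycle x, a, y, b. *)
Lemma common_neighbor_uniq x y a b :
  x != y -> e x a -> e a y -> e x b -> e b y -> a = b.
Proof.
move=> xy exa eay exb eby; apply/eqP; apply: contraT => ab.
suff /girth_icycle : icycle e [tuple x; a; y; b; x] by move/(_ isT).
apply/and3P; split=> //; first by rewrite /= exa eay e_sym eby e_sym exb.
by rewrite /= !inE !negb_or xy ab !(adj_neq e_irr) // e_sym.
Qed.

(** The right-hand sum is 2. For distinct x and y the absence of triangles makes their distance
    exactly 2; for x = y it is 0. *)
Lemma smooth_adj x z y : e x z -> e z y ->
  (dist e x y == dist e x z + dist e z y)%E = (x != y).
Proof.
move=> exz ezy; rewrite (dist_adj e_irr exz) // (dist_adj e_irr ezy) //.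
have [->|xy] := eqVneq x y; first by rewrite dist_refl.
by rewrite (dist_eq2 exz ezy) ?eqxx ?no_triangle // (no_triangle exz).
Qed.

End ShortCycles.

(** * Generators on the diagonal as walks, and their faces *)

Section Walks.
Import Order.TTheory GRing.Theory Num.Theory.
Variables (T : finType) (e : rel T).

Lemma vtx_nth k (s : k.+1.-tuple T) x0 i : i <= k -> vtx s i = nth x0 s i.
Proof. by move=> ik; apply: set_nth_default; rewrite size_tuple. Qed.

Lemma vtx_inj k (s t : k.+1.-tuple T) :
  (forall i, i <= k -> vtx s i = vtx t i) -> s = t.
Proof.
move=> st; apply/val_inj/(@eq_from_nth _ (thead s)); rewrite ?size_tuple // => i ik.
by rewrite -!vtx_nth ?st.
Qed.

Lemma len_shift k (s : k.+1.-tuple T) :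
  len e s = (\sum_(0 <= i < k) dist e (vtx s i) (vtx s i.+1))%R.
Proof. by rewrite /len big_add1. Qed.

Lemma is_gen_neq k l (s : k.+1.-tuple T) :
  is_gen e l s -> forall i, i < k -> vtx s i != vtx s i.+1.
Proof. by case/andP=> /forallP neq _ i ik; exact: (neq (Ordinal ik)). Qed.

Lemma is_gen_leq k l (s : k.+1.-tuple T) : is_gen e l s -> k <= l.
Proof.
move=> gs; have [|] := @esum_ge1_eq k (fun i => dist e (vtx s i) (vtx s i.+1)).
  by move=> i /(is_gen_neq gs); exact: dist_ge1.
by rewrite -len_shift; case/andP: gs => _ /eqP ->; rewrite lee_fin lez_nat.
Qed.

Lemma is_gen_diag k (s : k.+1.-tuple T) :
  is_gen e k s -> forall i, i < k -> e (vtx s i) (vtx s i.+1).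
Proof.
move=> gs; have [|] := @esum_ge1_eq k (fun i => dist e (vtx s i) (vtx s i.+1)).
  by move=> i /(is_gen_neq gs); exact: dist_ge1.
rewrite -len_shift; case/andP: gs => _ /eqP -> _ /(_ erefl) d1 i ik.
exact/dist_eq1/d1.
Qed.

Lemma del_size k i (s : k.+2.-tuple T) : i <= k.+1 -> size (del i s) == k.+1.
Proof.
by move=> ik; rewrite size_cat size_takel ?size_drop size_tuple; lia.
Qed.

Definition del_tuple k (s : k.+2.-tuple T) i (ik : i <= k.+1) : k.+1.-tuple T :=
  Tuple (del_size s ik).

Lemma nth_del x0 i (s : seq T) j :
  i < size s -> nth x0 (del i s) j = nth x0 s (bump i j).
Proof.
move=> /ltnW ilt; rewrite nth_cat size_takel // /bump.
case: (leqP i j) => ij; last by rewrite nth_take.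
by rewrite nth_drop; congr nth; lia.
Qed.

Lemma vtx_del k (s : k.+2.-tuple T) i (ik : i <= k.+1) j :
  j <= k -> vtx (del_tuple s ik) j = vtx s (bump i j).
Proof.
move=> jk; rewrite (vtx_nth _ (thead s)) // nth_del ?size_tuple //.
Qed.

Hypothesis e_irr : irreflexive e.

Lemma walk_is_gen k (s : k.+1.-tuple T) :
  (forall i, i < k -> e (vtx s i) (vtx s i.+1)) -> is_gen e k s.
Proof.
move=> es; apply/andP; split.
  by apply/forallP=> i; exact: (adj_neq e_irr (es i (ltn_ord i))).
rewrite len_shift (eq_big_nat _ _ (F2 := fun=> (1%R)%:E)) => [|i ik].
  by rewrite sumEFin big_const_nat subn0 iter_addr_0 natz.
by rewrite (dist_adj e_irr) ?es.
Qed.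

Hypotheses (e_sym : symmetric e) (girth_ge5 : (5%:E <= girth e)%E).

Lemma smooth_diag k (s : k.+1.-tuple T) i :
  is_gen e k s -> 0 < i < k -> smooth e s i = (vtx s i.-1 != vtx s i.+1).
Proof.
move=> gs; case: i => //= i ik; have es := is_gen_diag gs.
by apply: (smooth_adj e_sym e_irr girth_ge5); apply: es; lia.
Qed.

(** The face has one step fewer, but the step bridging the deleted vertex has length 2, so the total
    stays k + 1. *)
Lemma del_is_gen k (s : k.+2.-tuple T) i (ik : i <= k.+1) :
  is_gen e k.+1 s -> 0 < i <= k -> vtx s i.-1 != vtx s i.+1 ->
  is_gen e k.+1 (del_tuple s ik).
Proof.
move=> gs i_in nb; have es := is_gen_diag gs.
(* The bridging step has index i - 1 in the face; all other steps are edges of the walk. *)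
have dd j : 0 <= j < k -> dist e (vtx (del_tuple s ik) j) (vtx (del_tuple s ik) j.+1)
   = (((1 + (j == i.-1))%N : nat)%:Z)%:E.
  move=> /andP[_ jk]; rewrite !vtx_del; try lia.
  have [ji|[ji|ji]] : j.+1 < i \/ j.+1 = i \/ i <= j by lia.
  - have -> : bump i j = j by rewrite /bump; lia.
    have -> : bump i j.+1 = j.+1 by rewrite /bump; lia.
    have -> : (j == i.-1) = false by lia.
    by rewrite (dist_adj e_irr) //; apply: es; lia.
  - have -> : bump i j = i.-1 by rewrite /bump; lia.
    have -> : bump i j.+1 = i.+1 by rewrite /bump; lia.
    have -> : (j == i.-1) = true by lia.
    have e1 : e (vtx s i.-1) (vtx s i) by rewrite -ji; apply: es; lia.
    have e2 : e (vtx s i) (vtx s i.+1) by apply: es; lia.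
    exact: dist_eq2 e1 e2 (no_triangle e_sym e_irr girth_ge5 e1 e2) nb.
  - have -> : bump i j = j.+1 by rewrite /bump; lia.
    have -> : bump i j.+1 = j.+2 by rewrite /bump; lia.
    have -> : (j == i.-1) = false by lia.
    by rewrite (dist_adj e_irr) //; apply: es; lia.
apply/andP; split.
  apply/forallP=> -[j jk]; apply/eqP=> eq_v; have := dd j jk.
  by rewrite /= eq_v dist_refl.
rewrite len_shift (eq_big_nat _ _ dd) sumEFin.
rewrite -(big_morph Posz PoszD (erefl _)) big_split /= sum_nat_const_nat.
rewrite (bigD1_seq i.-1) ?iota_uniq ?mem_index_iota //=; last lia.
rewrite eqxx big1 => [|j /negPf -> //].
by apply/eqP; congr (EFin (Posz _)); lia.
Qed.

(* Deleting x_i leaves a single step of length 2, which locates i; the deleted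
   vertex is then the only common neighbor of its endpoints. *)
Lemma del_inj k (s t : k.+2.-tuple T) i j :
  is_gen e k.+1 s -> is_gen e k.+1 t -> 0 < i <= k -> 0 < j <= k ->
  vtx s i.-1 != vtx s i.+1 -> vtx t j.-1 != vtx t j.+1 ->
  del i s = del j t -> i = j /\ s = t.
Proof.
wlog ij : s t i j / i <= j => [hw|] gs gt i_in j_in nbs nbt st.
  have [|/ltnW ji] := leqP i j; first by move/hw; apply.
  by have [] := hw t s j i ji gt gs j_in i_in nbt nbs (esym st).
have es := is_gen_diag gs; have et := is_gen_diag gt.
have eq_bump m : m <= k -> vtx s (bump i m) = vtx t (bump j m).
  move=> mk; rewrite !(vtx_nth _ (thead s)); try (rewrite /bump; lia).
  by rewrite -!nth_del ?size_tuple ?st //; lia.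
have e1 : e (vtx s i.-1) (vtx s i) by rewrite -{2}(@prednK i) ?es; lia.
have e2 : e (vtx s i) (vtx s i.+1) by apply: es; lia.
(* If i < j, deleting at j leaves positions i - 1 and i of [t] in place, so the neighbors of
   position i in [s] are consecutive in [t], hence adjacent: a triangle. *)
have {}ij : i = j.
  apply/eqP; rewrite eqn_leq ij leqNgt; apply/negP=> lt_ij.
  have := no_triangle e_sym e_irr girth_ge5 e1 e2.
  have := eq_bump i.-1; have := eq_bump i.
  have -> : bump i i = i.+1 by rewrite /bump; lia.
  have -> : bump i i.-1 = i.-1 by rewrite /bump; lia.
  have -> : bump j i = i by rewrite /bump; lia.
  have -> : bump j i.-1 = i.-1 by rewrite /bump; lia.
  move=> -> //; last lia. move=> ->; last lia.
  by rewrite -{2}(@prednK i) ?et //; lia.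
subst j; split=> //; apply: vtx_inj => m mk.
(* Every position other than i survives in the face, at index [unbump i n]. *)
have eq_off n : n <= k.+1 -> n != i -> vtx s n = vtx t n.
  move=> nk ni; have := eq_bump (unbump i n); rewrite unbumpK //; apply.
  by rewrite /unbump; lia.
have [->|/eq_off] := eqVneq m i; last exact.
apply: (common_neighbor_uniq e_sym e_irr girth_ge5 nbs e1 e2).
  rewrite eq_off; try lia.
  by rewrite -{2}(@prednK i) ?et; lia.
by rewrite eq_off ?et; lia.
Qed.

End Walks.

(** * The kernel of the boundary and its basis of alternating walks *)

Section DiagonalCycles.
Import Order.TTheory GRing.Theory Num.Theory.
Local Open Scope ring_scope.
Variables (T : finType) (e : rel T).
Hypotheses (e_sym : symmetric e) (e_irr : irreflexive e).

Definition dart := {p : T * T | e p.1 p.2}.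

(** Count darts by their unordered pair of ends: each edge has two orientations, distinct because
    there are no loops. *)
Lemma card_dart : #|{: dart}| = (2 * #|edges e|)%N.
Proof.
pose ends (p : T * T) := [set p.1; p.2].
rewrite card_sig -[LHS]sum1_card (partition_big ends (mem (edges e))) /=; last first.
  by case=> x y exy; apply/imset2P; exists x y; rewrite ?inE.
rewrite mulnC -sum_nat_const; apply: eq_bigr => E /imset2P[x y _].
rewrite inE => /andP[_ exy] ->; have xy := adj_neq e_irr exy.
rewrite sum1dep_card.
suff -> : [set p : T * T | e p.1 p.2 & ends p == [set x; y]]
          = [set (x, y); (y, x)] by rewrite cards2 xpair_eqE negb_and xy.
apply/setP=> -[a b]; rewrite !inE /ends !xpair_eqE /=.
apply/andP/orP => [[eab /eqP abxy]|[]/andP[/eqP -> /eqP ->]]; last 2 first.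
- by [].
- by rewrite e_sym exy setUC.
have : a \in [set x; y] by rewrite -abxy set21.
have : b \in [set x; y] by rewrite -abxy set22.
have := adj_neq e_irr eab; rewrite !inE.
by move=> ab /orP[]/eqP eb /orP[]/eqP ea; move: ab; rewrite ea eb !eqxx //; auto.
Qed.

Variable n : nat.
Hypothesis girth_ge5 : (5%:E <= girth e)%E.

Definition alt_tuple (p : T * T) : n.+2.-tuple T :=
  [tuple of mkseq (fun i => if odd i then p.2 else p.1) n.+2].

Lemma vtx_alt p i : (i <= n.+1)%N ->
  vtx (alt_tuple p) i = if odd i then p.2 else p.1.
Proof. by move=> ik; rewrite (vtx_nth _ p.1) // nth_mkseq. Qed.

Lemma alt_is_gen (d : dart) : is_gen e n.+1 (alt_tuple (val d)).
Proof.
apply: walk_is_gen => // i ik; rewrite !vtx_alt ?(ltnW ik) //=.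
by case: (odd i) (valP d) => /= ed; rewrite // e_sym.
Qed.

Definition alt_gen (d : dart) : gen e n.+1 n.+1 :=
  exist _ (alt_tuple (val d)) (alt_is_gen d).

Lemma alt_gen_inj : injective alt_gen.
Proof.
move=> d d' /(congr1 val) /= dd'; apply: val_inj.
have := vtx_alt (val d) (leq0n _); have := vtx_alt (val d) (ltn0Sn n).
rewrite dd' !vtx_alt //=.
by case: (val d) (val d') => [a b] [a' b'] /= -> ->.
Qed.

Lemma alt_gen_smooth d i : (0 < i <= n)%N -> ~~ smooth e (val (alt_gen d)) i.
Proof.
move=> i_in; rewrite (smooth_diag e_irr e_sym girth_ge5 (alt_is_gen d)); last lia.
rewrite negbK !vtx_alt; try lia.
by case: i i_in => //= i _; rewrite negbK.
Qed.

Lemma non_smooth_alt (s : gen e n.+1 n.+1) :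
  (forall i, (0 < i <= n)%N -> ~~ smooth e (val s) i) -> exists d, s = alt_gen d.
Proof.
case: s => s gs /= ns; have es := is_gen_diag gs.
exists (exist _ (vtx s 0, vtx s 1) (es 0%N isT) : dart).
apply/val_inj/vtx_inj => i ik /=.
(* Non-smoothness relates positions i and i + 2, so the induction carries two consecutive
   positions. *)
suff [] : ((i <= n.+1)%N -> vtx s i = vtx (alt_tuple (vtx s 0, vtx s 1)) i)
     /\ ((i.+1 <= n.+1)%N -> vtx s i.+1 = vtx (alt_tuple (vtx s 0, vtx s 1)) i.+1).
  by move=> vi _; exact: vi.
elim: i {ik} => [|i [IH1 IH2]]; first by split=> ?; rewrite vtx_alt.
split=> // ik.
have i_in : (0 < i.+1 <= n)%N by lia.
have /eqP <- : vtx s i == vtx s i.+2.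
  have := ns _ i_in; rewrite (smooth_diag e_irr e_sym girth_ge5 gs) ?negbK //.
rewrite IH1; last lia.
by rewrite !vtx_alt //= ?negbK //; lia.
Qed.

(* The face obtained by deleting a smooth vertex occurs in the boundary of no
   other generator, so the coefficient of [s] can be read off there. *)
Lemma cycle_smooth_coef (c : MC e n.+1 n.+1) (s : gen e n.+1 n.+1) i :
  bdS c = 0 -> (0 < i <= n)%N -> smooth e (val s) i -> c s = 0.
Proof.
move=> bc0 i_in sm.
have smoothE (u : gen e n.+1 n.+1) j : (0 < j <= n)%N ->
    smooth e (val u) j = (vtx (val u) j.-1 != vtx (val u) j.+1).
  move=> j_in; apply: (smooth_diag e_irr e_sym girth_ge5 (valP u)); lia.
have ik : (i <= n.+1)%N by lia.
have nb : vtx (val s) i.-1 != vtx (val s) i.+1 by rewrite -smoothE.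
pose t : gen e n n.+1 :=
  exist _ (del_tuple (val s) ik)
    (del_is_gen e_irr e_sym girth_ge5 ik (valP s) i_in nb).
have face u j : (0 < j <= n)%N -> smooth e (val u) j ->
    tval (val t) == del j (val u) -> u = s /\ j = i.
  move=> j_in smu /eqP tu; rewrite smoothE // in smu.
  have [-> su] := del_inj e_irr e_sym girth_ge5 (valP s) (valP u) i_in j_in nb smu tu.
  by split=> //; apply: val_inj.
have bd_other u : u != s -> bd_gen u t = 0.
  move=> us; rewrite ffunE big_seq_cond big1 // => j /andP[].
  rewrite mem_index_iota => j_in smu.
  case: eqP => [/eqP tu|]; last by rewrite mulr0.
  by have [uE _] := face u j j_in smu tu; rewrite uE eqxx in us.
have bd_self : bd_gen s t = (-1) ^+ i.
  rewrite ffunE big_mkcond (bigD1_seq i) ?iota_uniq ?mem_index_iota //=.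
  rewrite sm eqxx mulr1.
  rewrite big_seq_cond big1 ?addr0 // => j /andP[].
  rewrite mem_index_iota => j_in ji; case: ifP => // sms.
  case: eqP => [/eqP tu|]; last by rewrite mulr0.
  by have [_ jE] := face s j j_in sms tu; rewrite jE eqxx in ji.
have := congr1 (fun f : MC e n n.+1 => f t) bc0.
rewrite !ffunE (bigD1 s) //= big1 => [|u us]; last by rewrite bd_other ?mulr0.
by rewrite bd_self addr0 => /eqP; rewrite mulf_eq0 signr_eq0 orbF => /eqP.
Qed.

Lemma non_smooth_cycle (c : MC e n.+1 n.+1) :
  (forall s i, (0 < i <= n)%N -> smooth e (val s) i -> c s = 0) -> bdS c = 0.
Proof.
move=> c0; apply/ffunP=> t; rewrite !ffunE big1 // => s _.
rewrite ffunE big_distrr big_seq_cond big1 //= => i /andP[].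
by rewrite mem_index_iota => i_in sm; rewrite (c0 s i) ?mul0r.
Qed.

Definition dart_of (j : 'I_(2 * #|edges e|)) : dart :=
  enum_val (cast_ord (esym card_dart) j).

Lemma dart_of_bij : bijective dart_of.
Proof.
exists (fun d => cast_ord card_dart (enum_rank d)) => [j|d].
  by rewrite /dart_of enum_valK cast_ordKV.
by rewrite /dart_of cast_ordK enum_rankK.
Qed.

Definition alt_coefs (c : MC e n.+1 n.+1) : 'rV[int]_(2 * #|edges e|) :=
  \row_j c (alt_gen (dart_of j)).

Lemma alt_coefs_is_zmod_morphism : zmod_morphism alt_coefs.
Proof. by move=> c d; apply/rowP=> j; rewrite !mxE !ffunE. Qed.
HB.instance Definition _ :=
  GRing.isZmodMorphism.Build (MC e n.+1 n.+1) _ alt_coefs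
    alt_coefs_is_zmod_morphism.

(** The sum has at most one term, as distinct darts give distinct walks; it is empty, giving 0, on
    non-alternating generators. *)
Definition alt_chain (v : 'rV[int]_(2 * #|edges e|)) : MC e n.+1 n.+1 :=
  [ffun s => \sum_(j | alt_gen (dart_of j) == s) v 0 j].

Lemma alt_chainK : cancel alt_chain alt_coefs.
Proof.
move=> v; apply/rowP=> j; rewrite mxE ffunE (big_pred1 j) // => i /=.
by rewrite (inj_eq alt_gen_inj) (inj_eq (bij_inj dart_of_bij)).
Qed.

Lemma alt_chain_cycle v : bdS (alt_chain v) = 0.
Proof.
apply: non_smooth_cycle => s i i_in sm; rewrite ffunE big1 // => j /eqP sE.
by have := alt_gen_smooth (dart_of j) i_in; rewrite sE sm.
Qed.

Lemma alt_coefsK c : bdS c = 0 -> alt_chain (alt_coefs c) = c.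
Proof.
move=> bc0; apply/ffunP=> s; rewrite ffunE.
(* If [s] has a smooth vertex, both sides vanish at [s]; otherwise [s] is alternating and comes from
   exactly one index. *)
have [/existsP[i /andP[i0 sm]]|] :=
    boolP [exists i : 'I_n.+1, (0 < i)%N && smooth e (val s) i].
  have i_in : (0 < i <= n)%N by rewrite i0 -ltnS ltn_ord.
  rewrite (cycle_smooth_coef bc0 i_in sm) big1 // => j /eqP sE.
  by have := alt_gen_smooth (dart_of j) i_in; rewrite sE sm.
rewrite negb_exists => /forallP ns.
have [i /andP[i0 i_n]|d ->] := @non_smooth_alt s.
  by have := ns (Ordinal (i_n : i < n.+1)%N); rewrite i0.
have [j_of dK jK] := dart_of_bij.
rewrite (big_pred1 (j_of d)) => [|j]; first by rewrite mxE jK.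
by rewrite (inj_eq alt_gen_inj) -{1}(jK d) (inj_eq (bij_inj dart_of_bij)).
Qed.

Lemma bd_above_diag (c : MC e n.+2 n.+1) : bdS c = 0.
Proof.
apply/ffunP=> t; rewrite !ffunE big1 // => s _.
by have := is_gen_leq (valP s); rewrite ltnn.
Qed.

End DiagonalCycles.

Theorem corollary1p2 (T : finType) (e : rel T)
    (e_sym : symmetric e) (e_irr : irreflexive e) (T_nonempty : (0 < #|T|)%N)
    (l : nat) (l_ge1 : (1 <= l)%N) (girth_ge5 : (5%:E <= girth e)%E) :
  exists f : {additive MH e l l -> 'rV[int]_(2 * #|edges e|)}, bijective f.
Proof.
(* With l = n + 1 a walk has at least one step, so its first two vertices form a dart. *)
case: l l_ge1 => // n _.
apply: (homology_iso_kernel (F := @alt_coefs T e e_sym e_irr n)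
          (G := @alt_chain T e e_sym e_irr n)).
- exact: bd_above_diag.
- exact: alt_chain_cycle.
- exact: alt_chainK.
- exact: alt_coefsK.
Qed.
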